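(* Let $B$ be a separable Banach space, $p\in[1,\infty)$, $X\in L^p(\mathbb{P},B)$ with law $\mu$, let $\Pi_1=(P_{1,i})_i$ be a finite partition of $B$ made of Borel sets, $\hat\sigma_X:=\sigma(X^{-1}(\Pi_1))$ and $\hat X:=\mathbb{E}[X|\hat\sigma_X]$. Then $$\hat X=\sum_i x_i\,\mathbf{1}_{P_{1,i}}(X),\qquad\text{and the law of }\hat X\text{ is}\qquad \hat\mu=\sum_i\mu(P_{1,i})\,\delta_{x_i},$$ where the sums are over those $i$ with $\mu(P_{1,i})>0$ and $$x_i:=\frac{1}{\mu(P_{1,i})}\int_{P_{1,i}}x\,\mu(dx),$$ so that $x_i$ is the barycentre of the probability $\mu_i:=\frac{\mathbf{1}_{P_{1,i}}}{\mu(P_{1,i})}\cdot\mu$. Assume moreover that $Y\in L^p(\mathbb{P},B)$ has law $\nu$ and satisfies $\mathbb{E}[Y|X]=X$, let $\Pi_2=(P_{2,j})_j$ be a finite partition of $B$ made of Borel sets, $\hat\sigma_{X,Y}:=\sigma(X^{-1}(\Pi_1))\vee\sigma(Y^{-1}(\Pi_2))$, $\hat Y:=\mathbb{E}[Y|\hat\sigma_{X,Y}]$, and let $\pi$ be the joint law of $(X,Y)$. Then also $x_i=\frac{1}{\pi(P_{1,i}\times B)}\int_{P_{1,i}\times B}x\,\pi(dx,dy)$, and $$\hat Y=\sum_{i,j}y_{i,j}\,\mathbf{1}_{P_{1,i}\times P_{2,j}}(X,Y),\qquad\text{and the law of }\hat Y\text{ is}\qquad \hat\nu=\sum_{i,j}\pi(P_{1,i}\times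 P_{2,j})\,\delta_{y_{i,j}},$$ where the sums are over those $i,j$ with $\pi(P_{1,i}\times P_{2,j})>0$ and $$y_{i,j}:=\frac{1}{\pi(P_{1,i}\times P_{2,j})}\int_{P_{1,i}\times P_{2,j}}y\,\pi(dx,dy)=\int_B y\,\nu_{i,j}(dy),$$ so that $y_{i,j}$ is the barycentre of $\nu_{i,j}:=\pi_{i,j}\circ P_y^{-1}$, where $\pi_{i,j}:=\frac{\mathbf{1}_{P_{1,i}\times P_{2,j}}}{\pi(P_{1,i}\times P_{2,j})}\cdot\pi$ and $P_y:B\times B\to B$ is the projection onto the second coordinate. In particular, if $\Pi^n_1=(P^n_{1,i})_i,\Pi^n_2=(P^n_{2,j})_j$, $n\in\mathbb{N}$, are finite Borel partitions of $B$ such that for $k=1,2$ one has $\sigma(\Pi^n_k)\subseteq\sigma(\Pi^{n+1}_k)$ for all $n$ and $\sigma(\bigcup_n\Pi^n_k)=\mathcal{B}(B)$, then $X_n:=\mathbb{E}[X|\sigma(X^{-1}(\Pi^n_1))]$ and $Y_n:=\mathbb{E}[Y|\sigma(X^{-1}(\Pi^n_1))\vee\sigma(Y^{-1}(\Pi^n_2))]$ admit the explicit representations $$X_n=\sum_i x^n_i\,\mathbf{1}_{P^n_{1,i}}(X),\qquad Y_n=\sum_{i,j}y^n_{i,j}\,\mathbf{1}_{P^n_{1,i}\times P^n_{2,j}}(X,Y),$$ where the sums are over those $i$ with $\mu(P^n_{1,i})>0$, respectively over those $i,j$ with $\pi(P^n_{1,i}\times P^n_{2,j})>0$, and $$x^n_i:=\frac{1}{\mu(P^n_{1,i})}\int_{P^n_{1,i}}x\,\mu(dx),\qquad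 y^n_{i,j}:=\frac{1}{\pi(P^n_{1,i}\times P^n_{2,j})}\int_{P^n_{1,i}\times P^n_{2,j}}y\,\pi(dx,dy).$$
   Context: $(\Omega,\mathcal{F},\mathbb{P})$ is the underlying probability space; $\mathcal{B}(B)$ is the Borel $\sigma$-algebra of $B$; $L^p(\mathbb{P},B)$ is the space of $B$-valued random variables $X$ with $\mathbb{E}\|X\|^p<\infty$; integrals of $B$-valued functions and conditional expectations are in the Bochner sense, and equalities between random variables are almost sure. For a partition $\Pi$ of $B$, $X^{-1}(\Pi):=\{X^{-1}(P):P\in\Pi\}$. The barycentre of a probability $\gamma$ on $B$ with finite first moment is $\int_B x\,\gamma(dx)$. For a measure $\gamma$ and a function $g\geq 0$, $g\cdot\gamma$ denotes the measure with density $g$ with respect to $\gamma$. *)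

(* Defs.v *)
From mathcomp Require Import all_boot all_order all_algebra.
From mathcomp Require Import all_classical all_reals all_analysis.

Set Implicit Arguments.
Unset Strict Implicit.
Unset Printing Implicit Defensive.

Import Order.TTheory GRing.Theory Num.Theory.
Import numFieldNormedType.Exports.

Local Open Scope classical_set_scope.
Local Open Scope ring_scope.

Definition separable (T : topologicalType) : Prop :=
  exists2 D : set T, countable D & dense D.

(* The space [B] with its Borel sigma-algebra. On [borel B * borel B] the
   library's product sigma-algebra is the Borel one as soon as [B] is
   separable. *)
Notation borel B := (g_sigma_algebraType (@open B)).

Section bochner.
Context {d} {T : measurableType d} {R : realType}
  {B : completeNormedModType R}.
Implicit Types (mu : set T -> \bar R) (D : set T) (f s : T -> B).

(* [mu] is a bare set function, as for the library's [integral]; only its values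
   on measurable sets matter. *)
Definition integrable_simple mu D s : Prop :=
  [/\ measurable_fun setT (s : T -> borel B), finite_set (range s) &
      (\int[mu]_(t in D) `|s t|%:E < +oo)%E].

(* The level set of 0 may have infinite measure: its term is 0 anyway. *)
Definition simple_integral mu D s : B :=
  \sum_(b \in range s) fine (mu (D `&` s @^-1` [set b])) *: b.

Definition has_bochner_integral mu D f (v : B) : Prop :=
  measurable_fun D (f : T -> borel B) /\
  exists s : nat -> T -> B,
    [/\ forall n, integrable_simple mu D (s n),
        (\int[mu]_(t in D) `|f t - s n t|%:E)%E @[n --> \oo] --> 0%E &
        simple_integral mu D (s n) @[n --> \oo] --> v].

Definition bochner_integrable mu D f : Prop :=
  exists v, has_bochner_integral mu D f v.

(* The Bochner integral of [f] over [D], and 0 when it does not exist. *)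
Definition bochner mu D f : B := xget 0 [set v | has_bochner_integral mu D f v].

Definition cell_mean mu D f : B := (fine (mu D))^-1 *: bochner mu D f.

(* The measure [g . mu]. *)
Definition density mu (g : T -> R) : set T -> \bar R :=
  fun A => (\int[mu]_(t in A) (g t)%:E)%E.

Definition cell_density mu D : T -> R := fun t => \1_D t / fine (mu D).

End bochner.

Section random_variables.
Context {d} {Omega : measurableType d} {R : realType}
  {B : completeNormedModType R}.
Implicit Types (P : probability Omega R) (G : set (set Omega)).

Definition in_Lp P (p : R) (X : {RV P >-> borel B}) : Prop :=
  ('E_P[(fun w => `|(X w : B)| `^ p)%R] < +oo)%E.

Definition is_cond_exp P G (X Z : Omega -> B) : Prop :=
  [/\ forall A : set (borel B), measurable A -> G (Z @^-1` A),
      bochner_integrable P setT Z &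
      forall A, G A -> bochner P A Z = bochner P A X].

(* Some version of E[X | G]; it is only meaningful up to almost sure equality. *)
Definition cond_exp P G (X : Omega -> B) : Omega -> B :=
  xget (cst 0) [set Z | is_cond_exp P G X Z].

Definition sigma_preimages n (X : Omega -> B) (Pi : 'I_n -> set B) :
  set (set Omega) := <<s [set X @^-1` Q | Q in range Pi] >>.

End random_variables.

(* Empty cells are allowed. *)
Definition finite_borel_partition (R : realType) (B : completeNormedModType R)
    n (Pi : 'I_n -> set B) : Prop :=
  [/\ forall i, measurable (Pi i : set (borel B)),
      trivIset setT Pi & cover setT Pi = setT].

Section barycentre.
Context {R : realType} {B : completeNormedModType R}.
Implicit Types gamma : set (borel B) -> \bar R.

Definition is_probability_with_first_moment gamma : Prop :=
  (exists Q : probability (borel B) R, forall A, measurable A -> gamma A = Q A)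
  /\ (\int[gamma]_x `|(x : B)|%:E < +oo)%E.

Definition barycentre gamma : B := bochner gamma setT (fun x : borel B => x : B).

End barycentre.

(* Main.v *)
From HB Require Import structures.
Require Import Defs.
From mathcomp Require Import all_boot all_order all_algebra finmap.
From mathcomp Require Import all_classical all_reals all_analysis.
From mathcomp Require Import measurable_realfun.

Set Implicit Arguments.
Unset Strict Implicit.
Unset Printing Implicit Defensive.

Import Order.TTheory GRing.Theory Num.Theory.
Import numFieldNormedType.Exports.

Local Open Scope classical_set_scope.
Local Open Scope ring_scope.

(** The sigma-algebra generated by a finite partition consists of the unions of
    its cells. A map measurable for it is therefore constant on every cell: the
    preimage of the singleton of one of its values is such a union, and contains
    each cell that it meets. If that map is moreover a version of E[X | G], then
    integrating over a cell of positive mass identifies the constant: it is the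
    mean of X over the cell ([cond_exp_cell]). The cells of mass zero form a
    negligible set, which gives the almost sure formula and the law
    ([cond_exp_partition_ae], [cond_exp_partition_law]). As the conditional
    expectation is a chosen version, with a default value when there is none,
    existence has to be established too: the candidate is the map equal to the
    cell mean on each cell, and additivity of the integral over the partition
    shows that it qualifies ([is_cond_exp_cond_exp]).

    This applies to X with the partition by the events X in P_1i, and to Y with
    the partition by the events (X, Y) in P_1i x P_2j, whose sigma-algebra is the
    join of the two given ones ([g_sigma_join]). A change of variables turns means
    over events into means under the laws mu and pi ([cell_mean_distribution]),
    and passing to the conditioned measure turns these into barycentres
    ([cell_mean_barycentre]).

    All this rests on a few facts about the Bochner integral. For a dense sequence
    [b], the simple maps [nearest b n \o f], sending [t] to a point closest to
    [f t] among 0 and the first [n] terms of [b], converge to [f] pointwise with an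
    error at most the norm of [f], hence in mean. With the inequality
    [norm_simple_integralB] and completeness this gives existence and uniqueness of
    the integral ([bochnerP]). These simple maps depend neither on the measure nor
    on the domain, so that each identity between Bochner integrals (additivity in
    the domain, change of variables, conditioning) is the limit of the same, purely
    finite, identity between simple integrals. *)

(** * Norms of measurable vector-valued maps *)

Section borel_norm.
Context {R : realType} {B : completeNormedModType R}.

Lemma open_measurable_borel (U : set B) :
  open U -> measurable (U : set (borel B)).
Proof. by move=> oU; exact: sub_sigma_algebra. Qed.

Lemma measurable_singleton_borel (b : B) :
  measurable ([set b] : set (borel B)).
Proof.
rewrite -[X in measurable X]setCK; apply: measurableC.
apply: open_measurable_borel; apply: closed_openC.
exact: accessible_closed_set1 (hausdorff_accessible (@norm_hausdorff _ B)) b.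
Qed.

Lemma measurable_dist_borel (b : B) :
  measurable_fun setT (fun x : borel B => `|(x : B) - b|).
Proof.
apply: (measurability _ (RGenOpens.measurableE R)).
move=> _ [_ [l [u ->]] <-]; rewrite setTI; apply: open_measurable_borel.
apply: (@open_comp _ _ (fun x : B => `|x - _|)); last exact: interval_open.
move=> x _; apply: (@cvg_comp _ _ _ (fun y : B => y - b) Num.norm).
  by apply: cvgB; [exact: cvg_id|exact: cvg_cst].
exact: norm_continuous.
Qed.

Lemma measurable_norm_borel :
  measurable_fun setT (fun x : borel B => `|(x : B)|).
Proof.
by have := measurable_dist_borel 0; under eq_fun do rewrite subr0.
Qed.

End borel_norm.

Section simple_maps.
Context {d} {T : measurableType d} {R : realType}
  {B : completeNormedModType R}.

Lemma measurable_fiber (s : T -> B) (b : B) :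
  measurable_fun setT (s : T -> borel B) -> measurable (s @^-1` [set b]).
Proof.
by move=> ms; rewrite -[X in measurable X]setTI; apply: ms => //;
  exact: measurable_singleton_borel.
Qed.

(** Fixing the value of [s] on each of its finitely many fibres reduces the claim
    to the distance to a constant, so that no measurability of the subtraction on
    the product space is involved. *)
Lemma measurable_dist_simple (D : set T) (f s : T -> B) :
  measurable D -> measurable_fun D (f : T -> borel B) ->
  measurable_fun setT (s : T -> borel B) -> finite_set (range s) ->
  measurable_fun D (fun t => `|f t - s t|).
Proof.
move=> mD mf ms fs _ A mA.
have -> : D `&` (fun t => `|f t - s t|) @^-1` A =
  \bigcup_(b in range s) (s @^-1` [set b] `&`
     (D `&` (fun t => `|f t - b|) @^-1` A)).
  apply/seteqP; split=> [t [Dt At]|t [_ [u _ <-]] [/= <- [Dt At]]].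
    by exists (s t); [exists t|].
  by [].
apply: fin_bigcup_measurable => // b _.
apply: measurableI; first exact: measurable_fiber.
suff : measurable_fun D (fun t => `|f t - b|) by exact.
apply: (@measurableT_comp _ _ _ _ _ _ (fun x : borel B => `|(x : B) - b|)).
  exact: measurable_dist_borel.
exact: mf.
Qed.

Lemma measurable_norm_comp (D : set T) (f : T -> B) :
  measurable_fun D (f : T -> borel B) ->
  measurable_fun D (fun t => `|f t|).
Proof.
move=> mf; apply: (@measurableT_comp _ _ _ _ _ _ (fun x : borel B => `|(x : B)|)).
  exact: measurable_norm_borel.
exact: mf.
Qed.

End simple_maps.

(** * Nearest-point approximation *)

(** Nearest-point projection onto [0], [b 0], ..., [b n.-1], the earliest point
    being kept in case of a tie. Starting from 0 bounds the error by the norm, as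
    needed for dominated convergence; the recursion makes measurability an
    induction on [n]. *)
Fixpoint nearest {R : realType} {B : completeNormedModType R} (b : nat -> B)
    (n : nat) (x : B) : B :=
  if n is m.+1 then
    if `|x - b m| < `|x - nearest b m x| then b m else nearest b m x
  else 0.

Section nearest.
Context {R : realType} {B : completeNormedModType R}.
Variable b : nat -> B.

Lemma finite_range_nearest n : finite_set (range (nearest b n)).
Proof.
elim: n => [|n ih].
  by apply: (@sub_finite_set _ _ [set 0]) => [_ [x _ <-]//|]; exact: finite_set1.
apply: (@sub_finite_set _ _ (range (nearest b n) `|` [set b n])).
  move=> _ [x _ <-] /=; case: ifPn => _; [by right|by left; exists x].
by rewrite finite_setU; split; [|exact: finite_set1].
Qed.

Lemma measurable_nearest n :
  measurable_fun setT (nearest b n : borel B -> borel B).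
Proof.
elim: n => [|n ih]; first exact: measurable_cst.
apply: measurable_fun_ifT => //.
apply: measurable_fun_ltr; first exact: measurable_dist_borel.
apply: measurable_dist_simple => //; exact: finite_range_nearest.
Qed.

Lemma measurable_nearest_comp {d} {T : measurableType d} (f : T -> B) n :
  measurable_fun setT (f : T -> borel B) ->
  measurable_fun setT (nearest b n \o f : T -> borel B).
Proof. by move=> mf; exact: (measurableT_comp (measurable_nearest n)). Qed.

Lemma finite_range_nearest_comp (T : Type) (f : T -> B) n :
  finite_set (range (nearest b n \o f)).
Proof.
apply: sub_finite_set (finite_range_nearest n).
by move=> _ [t _ <-]; exists (f t).
Qed.

Lemma dist_nearestS n x : `|x - nearest b n.+1 x| <= `|x - nearest b n x|.
Proof. by rewrite /=; case: ifPn => // /ltW. Qed.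

Lemma dist_nearest_le m n x : (m <= n)%N ->
  `|x - nearest b n x| <= `|x - nearest b m x|.
Proof.
elim: n => [|n ih]; first by rewrite leqn0 => /eqP ->.
rewrite leq_eqVlt => /orP[/eqP -> //|]; rewrite ltnS => /ih.
exact/le_trans/dist_nearestS.
Qed.

Lemma dist_nearest_norm n x : `|x - nearest b n x| <= `|x|.
Proof. by have := @dist_nearest_le 0 n x isT; rewrite /= subr0. Qed.

Lemma dist_nearest_lt m n x : (m < n)%N -> `|x - nearest b n x| <= `|x - b m|.
Proof.
move=> mn; apply: (le_trans (dist_nearest_le _ mn)) => /=.
by case: ifPn => //; rewrite -leNgt.
Qed.

Lemma cvg_nearest x : dense (range b) ->
  `|x - nearest b n x| @[n --> \oo] --> 0.
Proof.
move=> db; apply/cvgr0Pnorm_lt => e e0.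
have [|y [/= xy [m _ my]]] := db (ball x e) _ (@ball_open _ _ x e).
  by exists x; exact: ballxx.
exists m.+1 => // n /= mn; rewrite normr_id.
apply: (le_lt_trans (dist_nearest_lt _ mn)); rewrite my.
by move: xy; rewrite -ball_normE.
Qed.

End nearest.

(** An injection of a countable dense set into the naturals is inverted, with
    the value 0 outside its image; the extra point does not affect density. *)
Lemma separable_sequence {R : realType} {B : completeNormedModType R} :
  separable B -> exists b : nat -> B, dense (range b).
Proof.
move=> [D /countable_injP[f finj] dD].
exists (fun n => xget 0 [set x | D x /\ f x = n]) => O O0 oO.
have [x [Ox Dx]] := dD O O0 oO.
exists x; split=> //; exists (f x) => //.
apply: xget_unique => // y [Dy fyx].
by apply: finj; rewrite ?inE.
Qed.

(** * Integrals of simple maps *)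

Section simple_integral_theory.
Context {d} {T : measurableType d} {R : realType}
  {B : completeNormedModType R}.
Implicit Types (D : set T) (s : T -> B).

(** Fibres of values that are not taken are empty. An index set common to all maps
    makes it immediate to compare simple integrals of different maps. *)
Lemma simple_integralT (mu : {measure set T -> \bar R}) D s :
  simple_integral mu D s =
  \sum_(b \in setT) fine (mu (D `&` s @^-1` [set b])) *: b.
Proof.
apply: fsbig_widen => // b [_ nsb] /=.
by rewrite preimage10 // setI0 measure0 scale0r.
Qed.

Lemma simple_integral_const (mu : {measure set T -> \bar R}) D s b :
  (forall t, D t -> s t = b) -> simple_integral mu D s = fine (mu D) *: b.
Proof.
move=> sb; rewrite simple_integralT -(fsbig_widen [set b])//.
  rewrite fsbig_set1; congr (fine (mu _) *: _).
  by apply/seteqP; split=> [t []//|t Dt]; split=> //=; exact: sb.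
move=> c [_ /= cb]; rewrite (_ : _ `&` _ = set0) ?measure0 ?scale0r//.
by apply/seteqP; split=> // t [Dt /= sc]; apply: cb; rewrite -sc; exact: sb.
Qed.

Variable mu : {finite_measure set T -> \bar R}.

Lemma fine_measure_cover (I : choiceType) (J : set I) (C : I -> set T) D :
  finite_set J -> (forall i, J i -> measurable (C i)) ->
  trivIset J C -> measurable D -> D `<=` \bigcup_(i in J) C i ->
  fine (mu D) = \sum_(i \in J) fine (mu (D `&` C i)).
Proof.
move=> fJ mC tC mD DC.
have -> : mu D = (\sum_(i \in J) mu (D `&` C i))%E.
  rewrite -measure_fin_bigcup//.
  - by congr (mu _); rewrite -setI_bigcupr; apply/esym/setIidPl.
  - exact: trivIset_setIl.
  - by move=> i Ji; apply: measurableI => //; exact: mC.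
rewrite !fsbig_finite//= big_seq_cond [RHS]big_seq_cond sum_fine// => i.
rewrite andbT in_fset_set// inE => Ji.
by apply: fin_num_measure; apply: measurableI => //; exact: mC.
Qed.

(** Regrouping the fibres of [u] according to the value of [g]. With [u] a pair of
    simple maps and [g] a projection, this writes two simple integrals over one
    common family of fibres. *)
Lemma simple_integral_comp (C : choiceType) (u : T -> C) (g : C -> B) D :
  finite_set (range u) -> (forall c, measurable (u @^-1` [set c])) ->
  measurable D ->
  simple_integral mu D (g \o u) =
  \sum_(c \in range u) fine (mu (D `&` u @^-1` [set c])) *: g c.
Proof.
move=> fu mu_ mD.
have fgu : finite_set (range (g \o u)).
  by rewrite -(image_comp u g); exact: finite_image.
pose F c b := (if g c == b then fine (mu (D `&` u @^-1` [set c])) else 0) *: b.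
transitivity (\sum_(b \in range (g \o u)) \sum_(c \in range u) F c b).
  apply: eq_fsbigr => b _.
  rewrite (@fine_measure_cover _ (range u) (fun c => u @^-1` [set c]))//.
  - rewrite !fsbig_finite// scaler_suml; apply: eq_bigr => c _.
    rewrite /F; case: eqP => [gcb|gcb].
      congr (fine (mu _) *: _); apply/seteqP; split=> [t [[]]//|t [Dt uc]].
      by split=> //; split=> //=; rewrite -gcb uc.
    rewrite (_ : _ `&` _ = set0) ?measure0//.
    by apply/seteqP; split=> // t [[_ /= gub] /= uc]; apply: gcb; rewrite -uc.
  - exact: trivIset_preimage1.
  - apply: measurableI => //.
    have -> : (g \o u) @^-1` [set b] =
        \bigcup_(c in range u `&` g @^-1` [set b]) u @^-1` [set c].
      apply/seteqP; split=> [t gub|t [c [_ /= gcb] /= uc]].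
        by exists (u t) => //; split=> //; exists t.
      by rewrite /= uc.
    apply: fin_bigcup_measurable => //; exact: finite_setIl.
  - by move=> t _; exists (u t) => //; exists t.
rewrite exchange_fsbig//; apply: eq_fsbigr => c; rewrite inE => -[t _ utc].
rewrite -(fsbig_widen [set g c])//.
- by rewrite fsbig_set1 /F eqxx.
- by move=> _ ->; exists t => //=; rewrite utc.
- by move=> b [_ /= bgc]; rewrite /F; case: eqP => [/esym//|]; rewrite scale0r.
Qed.

(** Both integrals are sums over the fibres of the pair [(s, s')], where the
    triangle inequality applies term by term. *)
Lemma norm_simple_integralB D s s' :
  measurable_fun setT (s : T -> borel B) -> finite_set (range s) ->
  measurable_fun setT (s' : T -> borel B) -> finite_set (range s') ->
  measurable D ->
  (`|simple_integral mu D s - simple_integral mu D s'|%:E <=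
   \int[mu]_(t in D) `|s t - s' t|%:E)%E.
Proof.
move=> ms fs ms' fs' mD.
pose u t := (s t, s' t).
have fu : finite_set (range u).
  apply: (@sub_finite_set _ _ (range s `*` range s')); last exact: finite_setX.
  by move=> _ [t _ <-]; split; exists t.
have mu_ c : measurable (u @^-1` [set c]).
  rewrite (_ : _ @^-1` _ = s @^-1` [set c.1] `&` s' @^-1` [set c.2]).
    by apply: measurableI; exact: measurable_fiber.
  by case: c => c1 c2; apply/seteqP; split=> [t [<- <-]//|t /= [<- <-]].
rewrite (_ : simple_integral mu D s = simple_integral mu D (fst \o u))//.
rewrite (_ : simple_integral mu D s' = simple_integral mu D (snd \o u))//.
rewrite !simple_integral_comp//.
have -> : (\int[mu]_(t in D) `|s t - s' t|%:E)%E =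
    (\sum_(c \in range u) `|c.1 - c.2|%:E * mu (D `&` u @^-1` [set c]))%E.
  have DE : D = \big[setU/set0]_(c <- fset_set (range u))
      (D `&` u @^-1` [set c]).
    rewrite bigsetU_fset_set// -setI_bigcupr; apply/esym/setIidPl => t _.
    by exists (u t) => //; exists t.
  rewrite {1}DE ge0_integral_bigsetU//.
  - rewrite fsbig_finite//; apply: eq_bigr => c _.
    rewrite (eq_integral (cst `|c.1 - c.2|%:E)).
      by rewrite integral_cst//; exact: measurableI.
    by move=> t; rewrite inE => -[_ /= <-].
  - by move=> c; exact: measurableI.
  - apply: trivIset_setIl; exact: trivIset_preimage1.
  - rewrite -DE; apply/measurable_EFinP.
    by apply: measurable_dist_simple => //; exact: measurable_funS ms.
rewrite !fsbig_finite//= -sumrB.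
apply: (@le_trans _ _ (\sum_(c <- fset_set (range u))
   `|fine (mu (D `&` u @^-1` [set c])) *: c.1 -
     fine (mu (D `&` u @^-1` [set c])) *: c.2|)%:E).
  by rewrite lee_fin; exact: ler_norm_sum.
rewrite -sumEFin; apply: lee_sum => c _.
rewrite -scalerBr normrZ EFinM muleC.
rewrite ger0_norm ?fine_ge0// fineK//.
by apply: fin_num_measure; exact: measurableI.
Qed.

End simple_integral_theory.

(** * Existence and uniqueness of the Bochner integral *)

Section bochner_theory.
Context {d} {T : measurableType d} {R : realType}
  {B : completeNormedModType R}.
Variable mu : {finite_measure set T -> \bar R}.
Implicit Types (D : set T) (f : T -> B) (s : nat -> T -> B).

Lemma norm_simple_integralB_approx D f (s s' : T -> B) : measurable D ->
  measurable_fun D (f : T -> borel B) ->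
  integrable_simple mu D s -> integrable_simple mu D s' ->
  (`|simple_integral mu D s - simple_integral mu D s'|%:E <=
   \int[mu]_(t in D) `|f t - s t|%:E + \int[mu]_(t in D) `|f t - s' t|%:E)%E.
Proof.
move=> mD mf [ms fs _] [ms' fs' _].
apply: (le_trans (norm_simple_integralB mu ms fs ms' fs' mD)).
have mfs : measurable_fun D (fun t => `|f t - s t|%:E).
  by apply/measurable_EFinP; exact: measurable_dist_simple.
have mfs' : measurable_fun D (fun t => `|f t - s' t|%:E).
  by apply/measurable_EFinP; exact: measurable_dist_simple.
rewrite -ge0_integralD//.
apply: ge0_le_integral => //.
- apply/measurable_EFinP; apply: measurable_dist_simple => //.
  exact: measurable_funTS.
- exact: emeasurable_funD.
- move=> t _; rewrite -EFinD lee_fin.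
  by rewrite (le_trans (ler_distD (f t) _ _))// (distrC (s t)).
Qed.

(** Two approximating sequences of the same map are compared at two independent
    indices: distinct sequences yield uniqueness of the integral, and a single one
    compared with itself yields the Cauchy property. *)
Lemma simple_integral_approx_close D f s s' : measurable D ->
  measurable_fun D (f : T -> borel B) ->
  (forall n, integrable_simple mu D (s n)) ->
  (forall n, integrable_simple mu D (s' n)) ->
  (\int[mu]_(t in D) `|f t - s n t|%:E)%E @[n --> \oo] --> 0%E ->
  (\int[mu]_(t in D) `|f t - s' n t|%:E)%E @[n --> \oo] --> 0%E ->
  forall e, 0 < e -> exists N, forall n m, (N <= n)%N -> (N <= m)%N ->
    `|simple_integral mu D (s n) - simple_integral mu D (s' m)| < e.
Proof.
move=> mD mf is_ is'_ s0 s'0 e e0.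
have nbhs_e : nbhs (0 : \bar R)%E [set x | x < (e / 2)%:E]%E.
  apply: open_nbhs_nbhs; split; first exact: open_ereal_lt_ereal.
  by rewrite /= lte_fin divr_gt0.
have [N _ sN] := s0 _ nbhs_e; have [N' _ s'N'] := s'0 _ nbhs_e.
exists (maxn N N') => n m; rewrite !geq_max => /andP[Nn _] /andP[_ N'm].
rewrite -lte_fin.
apply: (le_lt_trans (norm_simple_integralB_approx mD mf (is_ n) (is'_ m))).
by rewrite [in ltRHS](splitr e) EFinD; apply: lteD; [exact: sN|exact: s'N'].

Qed.

Lemma has_bochner_integral_unique D f v w : measurable D ->
  has_bochner_integral mu D f v -> has_bochner_integral mu D f w -> v = w.
Proof.
move=> mD [mf [s [is_ s0 sv]]] [_ [s' [is'_ s'0 s'w]]].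
apply/eqP; rewrite -subr_eq0; apply/eqP.
have : (simple_integral mu D (s n) - simple_integral mu D (s' n))
    @[n --> \oo] --> v - w by exact: cvgB.
move/(@norm_cvg_unique _ _ _ _); apply.
apply/cvgr0Pnorm_lt => e e0.
have [N sN] := simple_integral_approx_close mD mf is_ is'_ s0 s'0 e0.
by exists N => // n /= Nn; exact: sN.
Qed.

Lemma bochner_unique D f v : measurable D ->
  has_bochner_integral mu D f v -> bochner mu D f = v.
Proof.
move=> mD fv; apply: xget_unique => // w fw.
exact: has_bochner_integral_unique fw fv.
Qed.

Lemma cvg_simple_integral_bochner D f s : measurable D ->
  measurable_fun D (f : T -> borel B) ->
  (forall n, integrable_simple mu D (s n)) ->
  (\int[mu]_(t in D) `|f t - s n t|%:E)%E @[n --> \oo] --> 0%E ->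
  simple_integral mu D (s n) @[n --> \oo] --> bochner mu D f /\
  has_bochner_integral mu D f (bochner mu D f).
Proof.
move=> mD mf is_ s0.
have /cvg_ex[v sv] : cvg (simple_integral mu D (s n) @[n --> \oo]).
  apply/cauchy_cvgP; apply: cauchy_exP => e e0.
  have [N sN] := simple_integral_approx_close mD mf is_ is_ s0 s0 e0.
  exists (simple_integral mu D (s N)); exists N => // n /= Nn.
  by rewrite -ball_normE /=; exact: sN.
have fv : has_bochner_integral mu D f v by split=> //; exists s.
by rewrite (bochner_unique mD fv).
Qed.

Variable b : nat -> B.
Hypothesis db : dense (range b).

Lemma integrable_simple_nearest D f n : measurable D ->
  measurable_fun setT (f : T -> borel B) ->
  (\int[mu]_(t in D) `|f t|%:E < +oo)%E ->
  integrable_simple mu D (nearest b n \o f).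
Proof.
move=> mD mf foo.
have ms : measurable_fun setT (nearest b n \o f : T -> borel B).
  exact: measurable_nearest_comp.
have mnf : measurable_fun D (fun t => `|f t|%:E).
  by apply/measurable_EFinP/measurable_norm_comp; exact: measurable_funTS.
split=> //.
  exact: finite_range_nearest_comp.
apply: (@le_lt_trans _ _ (\int[mu]_(t in D) (`|f t|%:E + `|f t|%:E))%E).
  apply: ge0_le_integral => //.
  - apply/measurable_EFinP/measurable_norm_comp; exact: measurable_funTS.
  - exact: emeasurable_funD.
  - move=> t _; rewrite -EFinD lee_fin -lerBlDl /=.
    apply: (le_trans _ (dist_nearest_norm b n (f t))).
    by rewrite -(distrC (nearest _ _ _)); exact: lerB_dist.
by rewrite ge0_integralD// lte_add_pinfty.
Qed.

Lemma cvg_dist_nearest D f : measurable D ->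
  measurable_fun setT (f : T -> borel B) ->
  (\int[mu]_(t in D) `|f t|%:E < +oo)%E ->
  (\int[mu]_(t in D) `|f t - (nearest b n \o f) t|%:E)%E @[n --> \oo] --> 0%E.
Proof.
move=> mD mf foo.
rewrite [X in _ --> X](_ : _ = \int[mu]_(t in D) (cst 0 t))%E; last first.
  by rewrite integral0.
apply: (@dominated_cvg _ _ _ mu D mD _ (cst 0%E) (fun t => `|f t|%:E)) => //.
- move=> n; apply/measurable_EFinP; apply: measurable_dist_simple => //.
  + exact: measurable_funTS.
  + exact: measurable_nearest_comp.
  + exact: finite_range_nearest_comp.
- move=> t _; apply/fine_cvgP; split; first exact: nearW.
  exact: cvg_nearest.
- apply/integrableP; split.
    by apply/measurable_EFinP/measurable_norm_comp; exact: measurable_funTS.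
  by under eq_integral do rewrite gee0_abs ?lee_fin//.
- by move=> n t _ /=; rewrite normr_id lee_fin dist_nearest_norm.
Qed.

(** The first half is the working tool for computing integrals: as the
    approximating sequence depends only on [f], an identity between simple
    integrals for varying measures and domains passes to the limit. *)
Lemma bochnerP D f : measurable D ->
  measurable_fun setT (f : T -> borel B) ->
  (\int[mu]_(t in D) `|f t|%:E < +oo)%E ->
  simple_integral mu D (nearest b n \o f) @[n --> \oo] --> bochner mu D f /\
  has_bochner_integral mu D f (bochner mu D f).
Proof.
move=> mD mf foo; apply: cvg_simple_integral_bochner => //.
- exact: measurable_funTS.
- by move=> n; exact: integrable_simple_nearest.
- exact: cvg_dist_nearest.
Qed.

End bochner_theory.

(** * Identities between Bochner integrals *)

Lemma measure_partition {d} {T : measurableType d} {R : realType}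
    (mu : {measure set T -> \bar R}) {I : finType} (C : I -> set T) A :
  (forall i, measurable (C i)) -> trivIset setT C -> cover setT C = setT ->
  measurable A -> mu A = (\sum_i mu (A `&` C i))%E.
Proof.
move=> mC tC cC mA; rewrite -[in LHS](setIT A) -cC /cover setI_bigcupr.
rewrite measure_fin_bigcup//.
- rewrite (fsbig_fwiden (index_enum I))//.
  + by move=> i _ /=; rewrite mem_index_enum.
  + exact: index_enum_uniq.
  + by move=> i [_ /(_ Logic.I)].
- exact: finite_finset.
- exact: trivIset_setIl.
- by move=> i _; exact: measurableI.
Qed.

Lemma integral_norm_subset {d} {T : measurableType d} {R : realType}
    {B : completeNormedModType R} (mu : {measure set T -> \bar R})
    (D E : set T) (f : T -> B) :
  measurable D -> measurable E -> D `<=` E ->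
  measurable_fun setT (f : T -> borel B) ->
  (\int[mu]_(t in E) `|f t|%:E < +oo)%E ->
  (\int[mu]_(t in D) `|f t|%:E < +oo)%E.
Proof.
move=> mD mE DE mf; apply: le_lt_trans; apply: ge0_subset_integral => //.
by apply/measurable_EFinP/measurable_norm_comp; exact: measurable_funTS.
Qed.

Section bochner_properties.
Context {d} {T : measurableType d} {R : realType}
  {B : completeNormedModType R}.
Hypothesis sepB : separable B.
Implicit Types (D : set T) (f : T -> B).

Lemma bochner_integrable_norm (mu : {finite_measure set T -> \bar R}) D f :
  measurable D -> measurable_fun setT (f : T -> borel B) ->
  (\int[mu]_(t in D) `|f t|%:E < +oo)%E ->
  bochner_integrable mu D f.
Proof.
move=> mD mf foo; have [b db] := separable_sequence sepB.
by exists (bochner mu D f); have [] := bochnerP db mD mf foo.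
Qed.

Lemma bochner_partition (mu : {finite_measure set T -> \bar R})
    (I : finType) (C : I -> set T) D f :
  (forall i, measurable (C i)) -> trivIset setT C -> cover setT C = setT ->
  measurable D -> measurable_fun setT (f : T -> borel B) ->
  (\int[mu]_(t in D) `|f t|%:E < +oo)%E ->
  bochner mu D f = \sum_i bochner mu (D `&` C i) f.
Proof.
move=> mC tC cC mD mf foo; have [b db] := separable_sequence sepB.
have mDC i : measurable (D `&` C i) by exact: measurableI.
have [cvD _] := bochnerP db mD mf foo.
have cvC i : simple_integral mu (D `&` C i) (nearest b n \o f)
    @[n --> \oo] --> bochner mu (D `&` C i) f.
  have fooi := integral_norm_subset (mDC i) mD (@subIsetl _ _ _) mf foo.
  by have [] := bochnerP db (mDC i) mf fooi.
have {}cvC : (\sum_i simple_integral mu (D `&` C i) (nearest b n \o f))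
    @[n --> \oo] --> \sum_i bochner mu (D `&` C i) f.
  by apply: cvg_big => //; exact: add_continuous.
apply: norm_cvg_unique cvD _; rewrite (_ : (fun _ => _) = fun n =>
  \sum_i simple_integral mu (D `&` C i) (nearest b n \o f))//.
apply/funext => n; set s := nearest b n \o f.
have ms : measurable_fun setT (s : T -> borel B).
  exact: measurable_nearest_comp.
have fs : finite_set (range s).
  exact: finite_range_nearest_comp.
rewrite /simple_integral fsbig_finite//.
under [RHS]eq_bigr do rewrite fsbig_finite//.
rewrite exchange_big; apply: eq_bigr => c _ /=.
rewrite -scaler_suml; congr (_ *: _).
have mE : measurable (D `&` s @^-1` [set c]).
  by apply: measurableI => //; exact: measurable_fiber.
rewrite (measure_partition mu mC tC cC mE) -sum_fine.
  by apply: eq_bigr => i _; rewrite setIAC.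
by move=> i _; apply: fin_num_measure; exact: measurableI.
Qed.

Lemma bochner_const (mu : {finite_measure set T -> \bar R}) D f c :
  measurable D -> measurable_fun setT (f : T -> borel B) ->
  (forall t, D t -> f t = c) -> bochner mu D f = fine (mu D) *: c.
Proof.
move=> mD mf fc; have [b db] := separable_sequence sepB.
have foo : (\int[mu]_(t in D) `|f t|%:E < +oo)%E.
  rewrite (eq_integral (cst `|c|%:E)); last first.
    by move=> t; rewrite inE => /fc ->.
  rewrite integral_cst//; apply: lte_mul_pinfty => //.
  by rewrite -ge0_fin_numE//; exact: fin_num_measure.
have [cv _] := bochnerP db mD mf foo; apply: norm_cvg_unique cv _.
rewrite (_ : (fun _ => _) = fun n => fine (mu D) *: nearest b n c).
  apply: cvgZl_tmp; apply/cvgrPdist_lt => e e0.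
  have := cvg_nearest c db; move/cvgr0Pnorm_lt => /(_ e e0).
  by apply: filterS => n; rewrite normr_id.
by apply/funext => n; apply: simple_integral_const => t /fc /= ->.
Qed.

Lemma bochner_null (mu : {finite_measure set T -> \bar R}) D f :
  measurable D -> measurable_fun setT (f : T -> borel B) ->
  (\int[mu]_(t in D) `|f t|%:E < +oo)%E -> mu D = 0%E ->
  bochner mu D f = 0.
Proof.
move=> mD mf foo D0; have [b db] := separable_sequence sepB.
have [cv _] := bochnerP db mD mf foo; apply: norm_cvg_unique cv _.
rewrite (_ : (fun _ => _) = fun=> 0); first exact: cvg_cst.
apply/funext => n; apply: fsbig1 => c _.
rewrite (_ : mu _ = 0%E) ?scale0r//.
apply: (subset_measure0 _ mD (@subIsetl _ _ _) D0).
apply: measurableI => //; apply: measurable_fiber.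
exact: measurable_nearest_comp.
Qed.

(** The fibres of [s \o X] are the preimages of those of [s], so that, summed over
    all values, the simple integrals of both sides agree term by term. *)
Lemma bochner_distribution {d'} {T' : measurableType d'}
    (P : probability T R) (X : {mfun T >-> T'}) (D : set T') (f : T' -> B) :
  measurable D -> measurable_fun setT (f : T' -> borel B) ->
  (\int[P]_(t in X @^-1` D) `|f (X t)|%:E < +oo)%E ->
  (\int[distribution P X]_(t in D) `|f t|%:E < +oo)%E /\
  bochner (distribution P X) D f = bochner P (X @^-1` D) (f \o X).
Proof.
move=> mD mf foo; have [b db] := separable_sequence sepB.
have foo' : (\int[distribution P X]_(t in D) `|f t|%:E < +oo)%E.
  rewrite ge0_integral_pushforward//.
  by apply/measurable_EFinP/measurable_norm_comp; exact: measurable_funTS.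
split=> //.
have mXD : measurable (X @^-1` D) by exact: measurable_funPTI.
have mfX : measurable_fun setT (f \o X : T -> borel B).
  exact: measurableT_comp.
have [cv _] := bochnerP db mD mf foo'; apply: norm_cvg_unique cv _.
have [cv' _] := bochnerP db mXD mfX foo.
rewrite (_ : (fun _ => _) = fun n =>
   simple_integral P (X @^-1` D) (nearest b n \o (f \o X)))//.
by apply/funext => n; rewrite !simple_integralT.
Qed.

End bochner_properties.

(** * Conditioned measures and barycentres *)

Section agreement.
Context {d} {T : measurableType d} {R : realType}.

(** The theory of the integral is about measures, whereas densities and their
    images are bare set functions: this is how it becomes applicable to them. *)
Lemma measure_of_agreement (gamma : set T -> \bar R)
    (Q : {measure set T -> \bar R}) :
  (forall A, 0 <= gamma A)%E -> (forall A, measurable A -> gamma A = Q A) ->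
  exists m : {measure set T -> \bar R}, gamma = m.
Proof.
move=> gamma0 gammaQ.
have g0 : gamma set0 = 0%E by rewrite gammaQ// measure0.
have gs : semi_sigma_additive gamma.
  move=> F mF tF mUF; rewrite gammaQ//.
  rewrite (_ : (fun _ => _) = fun n => (\sum_(0 <= i < n) Q (F i))%E).
    exact: measure_semi_sigma_additive.
  by apply/funext => n; apply: eq_bigr => i _; rewrite gammaQ.
have @m : {measure set T -> \bar R} :=
  HB.pack gamma (isMeasure.Build _ _ _ gamma g0 gamma0 gs).
by exists m.
Qed.

Context {B : completeNormedModType R}.

Lemma has_bochner_integral_eq_measure (m1 m2 : {measure set T -> \bar R})
    (f : T -> B) v :
  (forall A, measurable A -> m1 A = m2 A) ->
  has_bochner_integral m1 setT f v -> has_bochner_integral m2 setT f v.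
Proof.
move=> m12 [mf [s [is_ s0 sv]]].
have int12 (h : T -> \bar R) : (\int[m2]_t h t = \int[m1]_t h t)%E.
  by apply: eq_measure_integral => A mA _; rewrite m12.
split=> //; exists s; split.
- by move=> n; have [ms fs soo] := is_ n; split=> //; rewrite int12.
- by under eq_fun do rewrite int12.
- rewrite (_ : (fun _ => _) = fun n => simple_integral m1 setT (s n))//.
  apply/funext => n; have [ms _ _] := is_ n.
  apply: eq_fsbigr => c _; rewrite m12//.
  by apply: measurableI => //; exact: measurable_fiber.
Qed.

Lemma eq_measure_bochner (m1 m2 : {measure set T -> \bar R}) (f : T -> B) :
  (forall A, measurable A -> m1 A = m2 A) ->
  bochner m1 setT f = bochner m2 setT f.
Proof.
move=> m12; rewrite /bochner; congr (xget _ _).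
apply/seteqP; split=> v; apply: has_bochner_integral_eq_measure => // A mA.
by rewrite m12.
Qed.

End agreement.

Section conditioning.
Context {d} {T : measurableType d} {R : realType}
  {B : completeNormedModType R}.
Hypothesis sepB : separable B.
Variables (mu : probability T R) (D : set T).
Hypotheses (mD : measurable D) (D0 : (0 < mu D)%E).

(* The conditioned probability [mu (. | D)]; the last argument of [mnormalize] is
   the value it takes when [D] is null, which [D0] excludes. *)
Let cond : probability T R := mnormalize (mrestr mu mD) mu.

Let condE A : cond A = ((fine (mu D))^-1%:E * mu (A `&` D))%E.
Proof.
rewrite /cond /= /mnormalize /= /mrestr setTI gt_eqF//=.
rewrite ifF; first by rewrite muleC.
by apply: lt_eqF; rewrite -ge0_fin_numE//; exact: fin_num_measure.
Qed.

Let fine_D_gt0 : 0 < fine (mu D).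
Proof. by apply: fine_gt0; rewrite D0 -ge0_fin_numE//; exact: fin_num_measure. Qed.

Lemma density_cellE A : measurable A ->
  density mu (cell_density mu D) A = cond A.
Proof.
move=> mA; rewrite condE /density /cell_density.
under eq_integral do rewrite mulrC EFinM.
rewrite ge0_integralZl//.
- by rewrite integral_indic// setIC.
- by apply/measurable_EFinP; exact: measurable_indic.
- by rewrite lee_fin invr_ge0 ltW.
Qed.

(** The conditioned measure is at most [mu] divided by [mu D]. *)
Lemma integral_cond_lty (h : T -> R) :
  measurable_fun setT h -> (forall t, 0 <= h t) ->
  (\int[mu]_t (h t)%:E < +oo)%E -> (\int[cond]_t (h t)%:E < +oo)%E.
Proof.
move=> mh h0 hoo.
have c0 : 0 <= (fine (mu D))^-1 by rewrite invr_ge0 ltW.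
apply: (@le_lt_trans _ _ (\int[mscale (NngNum c0) mu]_t (h t)%:E)%E).
  apply: ge0_le_measure_integral => //.
  - move=> A mA; rewrite -[leLHS]/(cond A) condE /mscale/=; rewrite lee_pmul2l//.
    + by apply: le_measure; rewrite ?inE//; exact: measurableI.
    + by rewrite lte_fin invr_gt0.
  - exact/measurable_EFinP.
rewrite ge0_integral_mscale//; first exact: lte_mul_pinfty.
- exact/measurable_EFinP.
- by move=> t _; rewrite lee_fin.
Qed.

Lemma bochner_cond (f : T -> B) : measurable_fun setT (f : T -> borel B) ->
  (\int[mu]_t `|f t|%:E < +oo)%E ->
  bochner cond setT f = cell_mean mu D f.
Proof.
move=> mf foo; have [b db] := separable_sequence sepB.
have fcoo : (\int[cond]_t `|f t|%:E < +oo)%E.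
  by apply: integral_cond_lty => //; exact: measurable_norm_comp.
have fDoo := integral_norm_subset mD measurableT (@subsetT _ _) mf foo.
have [cv _] := bochnerP db measurableT mf fcoo.
apply: norm_cvg_unique cv _.
have [cvD _] := bochnerP db mD mf fDoo.
rewrite (_ : (fun _ => _) = fun n =>
    (fine (mu D))^-1 *: simple_integral mu D (nearest b n \o f)).
  exact: cvgZl_tmp.
apply/funext => n; rewrite /simple_integral.
have fs : finite_set (range (nearest b n \o f)).
  exact: finite_range_nearest_comp.
rewrite !fsbig_finite// scaler_sumr; apply: eq_bigr => c _.
rewrite scalerA setTI -[X in fine X *: _ = _]/(cond _) condE setIC fineM//.
apply: fin_num_measure; apply: measurableI => //; apply: measurable_fiber.
exact: measurable_nearest_comp.
Qed.

(** The measure [gamma] is the law of [phi] under the conditioned probability; its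
    barycentre is the integral of [phi] under that probability, by a change of
    variables. Taking [phi] to be the identity or a projection covers the
    barycentres of conditioned laws and of marginals of conditioned joint laws. *)
Lemma cell_mean_barycentre (phi : {mfun T >-> borel B}) :
  (\int[mu]_t `|(phi t : B)|%:E < +oo)%E ->
  let gamma := pushforward (density mu (cell_density mu D)) phi in
  is_probability_with_first_moment gamma /\
  cell_mean mu D (phi : T -> B) = barycentre gamma.
Proof.
move=> phioo gamma; pose Q : probability (borel B) R := distribution cond phi.
have gammaQ A : measurable A -> gamma A = Q A.
  by move=> mA; rewrite /gamma /pushforward density_cellE//;
    exact: measurable_funPTI.
have gamma_ge0 A : (0 <= gamma A)%E.
  apply: integral_ge0 => t _; rewrite lee_fin /cell_density.
  by rewrite divr_ge0// ltW.
have [m gammam] := measure_of_agreement gamma_ge0 gammaQ.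
have mQ A : measurable A -> m A = Q A by move=> mA; rewrite -gammam gammaQ.
have mphi : measurable_fun setT (phi : T -> borel B) by [].
have phicoo : (\int[cond]_t `|(phi t : B)|%:E < +oo)%E.
  by apply: integral_cond_lty => //; exact: measurable_norm_comp.
have [idoo idE] := bochner_distribution sepB measurableT
  (@measurable_id _ (borel B) setT) phicoo.
split; first split; first by exists Q.
- rewrite gammam (eq_measure_integral Q)// => A mA _; exact: mQ.
- rewrite /barycentre gammam (eq_measure_bochner _ mQ) idE.
  by rewrite -bochner_cond.
Qed.

End conditioning.

(** * Conditional expectation given a finite partition *)

Section finite_partition.
Context {T : pointedType} {I : finType} (C : I -> set T).
Hypotheses (tC : trivIset setT C) (cC : cover setT C = setT).

Lemma partition_cell w : exists i, C i w.
Proof. by have : cover setT C w by [rewrite cC]; move=> [i _ Ciw]; exists i. Qed.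

Lemma partition_cell_unique i j w : C i w -> C j w -> i = j.
Proof. by move=> Ciw Cjw; apply: tC => //; exists w. Qed.

Lemma g_sigma_partitionP (A : set T) :
  <<s range C >> A <-> exists S : set I, A = \bigcup_(i in S) C i.
Proof.
split=> [|[S ->]]; last first.
  apply: (@fin_bigcup_measurable _ (g_sigma_algebraType (range C))).
    exact: finite_finset.
  by move=> i _; apply: sub_sigma_algebra; exists i.
apply: (@smallest_sub _ _ _
    [set A | exists S : set I, A = \bigcup_(i in S) C i]); last first.
  by move=> _ [i _ <-]; exists [set i]; rewrite bigcup_set1.
split=> [|_ [S ->]|F FS].
- by exists set0; rewrite bigcup_set0.
- exists (~` S); apply/seteqP; split=> [w [_ nSw]|w [i nSi Ciw]].
    have [i Ciw] := partition_cell w; exists i => // Si.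
    by apply: nSw; exists i.
  by split=> // -[j Sj Cjw]; apply: nSi; rewrite (partition_cell_unique Ciw Cjw).
- have [S FE] := choice FS; exists (\bigcup_n S n).
  apply/seteqP; split=> [w [n _]|w [i [n _ Sni] Ciw]].
    by rewrite FE => -[i Sni Ciw]; exists i => //; exists n.
  by exists n => //; rewrite FE; exists i.
Qed.

(** The cells are the atoms of the sigma-algebra. *)
Lemma g_sigma_partition_atom (A : set T) i w :
  <<s range C >> A -> C i w -> A w -> C i `<=` A.
Proof.
move=> /g_sigma_partitionP[S ->] Ciw [j Sj Cjw] v Civ.
by exists j => //; rewrite -(partition_cell_unique Ciw Cjw).
Qed.

Lemma sum_indic_partition (R : realType) (V : lmodType R) (p : pred I)
    (x : I -> V) i w : C i w ->
  \sum_(j | p j) (\1_(C j) w : R) *: x j = if p i then x i else 0.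
Proof.
move=> Ciw; rewrite big_mkcond/= (bigD1 i)//= big1 ?addr0.
  by rewrite indicE mem_set// scale1r.
move=> j ji; case: ifP => // _; rewrite indicE memNset ?scale0r// => Cjw.
by move/eqP : ji; apply; exact: partition_cell_unique Cjw Ciw.
Qed.

End finite_partition.

Section cond_exp_partition.
Context {d} {Omega : measurableType d} {R : realType}
  {B : completeNormedModType R} {I : finType}.
Hypothesis sepB : separable B.
Variables (P : probability Omega R) (C : I -> set Omega).
Hypotheses (mC : forall i, measurable (C i)) (tC : trivIset setT C)
  (cC : cover setT C = setT).
Variable X : Omega -> B.
Hypotheses (mX : measurable_fun setT (X : Omega -> borel B))
  (Xoo : (\int[P]_w `|X w|%:E < +oo)%E).

Let G := <<s range C >>.
Let x_ i := cell_mean P (C i) X.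

Let G_measurable A : G A -> measurable A.
Proof.
apply: (@smallest_sub _ _ _ measurable); last by move=> _ [i _ <-].
exact: sigma_algebra_measurable.
Qed.

Let integral_lty (Z : Omega -> B) A : measurable A ->
  measurable_fun setT (Z : Omega -> borel B) ->
  (\int[P]_w `|Z w|%:E < +oo)%E -> (\int[P]_(w in A) `|Z w|%:E < +oo)%E.
Proof. by move=> mA mZ; exact: integral_norm_subset. Qed.

(* The candidate version of the conditional expectation, with the value 0 on null
   cells. *)
Let Z0 w := \sum_(i | (0 < P (C i))%E) (\1_(C i) w : R) *: x_ i.

Let Z0E i w : C i w -> Z0 w = if (0 < P (C i))%E then x_ i else 0.
Proof. exact: sum_indic_partition. Qed.

Let Z0_G (A : set (borel B)) : G (Z0 @^-1` A).
Proof.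
apply/g_sigma_partitionP => //.
exists [set i | A (if (0 < P (C i))%E then x_ i else 0)].
apply/seteqP; split=> [w AZ0|w [i Ai Ciw]]; last by rewrite /preimage/= (Z0E Ciw).
have [i Ciw] := partition_cell cC w; exists i => //.
by rewrite /= -(Z0E Ciw).
Qed.

Let mZ0 : measurable_fun setT (Z0 : Omega -> borel B).
Proof. by move=> _ A mA; rewrite setTI; apply: G_measurable; exact: Z0_G. Qed.

Let Z0oo : (\int[P]_w `|Z0 w|%:E < +oo)%E.
Proof.
pose M := \sum_(i | (0 < P (C i))%E) `|x_ i|.
apply: (@le_lt_trans _ _ (\int[P]_w (cst M%:E w))%E).
  apply: ge0_le_integral => //.
    exact/measurable_EFinP/measurable_norm_comp.
  move=> w _; rewrite lee_fin; apply: (le_trans (ler_norm_sum _ _ _)).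
  apply: ler_sum => i _; rewrite normrZ ger0_norm// ler_piMl//.
rewrite integral_cst//; apply: lte_mul_pinfty => //.
  by rewrite lee_fin; exact: sumr_ge0.
by rewrite -ge0_fin_numE//; exact: fin_num_measure.
Qed.

Let bochner_Z0_cell i : bochner P (C i) Z0 = bochner P (C i) X.
Proof.
rewrite (bochner_const sepB P (mC i) mZ0 (@Z0E i)).
have := measure_ge0 P (C i); rewrite le_eqVlt => /predU1P[Ci0|Ci0].
  by rewrite (bochner_null sepB (mC i) mX)// -?Ci0 ?scale0r//; exact: integral_lty.
rewrite Ci0 /x_ /cell_mean scalerA divff ?scale1r// gt_eqF//.
by apply: fine_gt0; rewrite Ci0 -ge0_fin_numE//; exact: fin_num_measure.
Qed.

(* A set of the sigma-algebra meets each cell in the whole cell or not at all, so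
   that by additivity it suffices to compare integrals over cells. *)
Let is_cond_exp_Z0 : is_cond_exp P G X Z0.
Proof.
split=> [A _||A GA]; first exact: Z0_G.
  exact: bochner_integrable_norm.
have mA := G_measurable GA.
have Z0Aoo := integral_lty mA mZ0 Z0oo; have XAoo := integral_lty mA mX Xoo.
rewrite (bochner_partition sepB mC tC cC mA mZ0 Z0Aoo).
rewrite (bochner_partition sepB mC tC cC mA mX XAoo).
apply: eq_bigr => i _.
have [->|/set0P[w [Aw Ciw]]] := eqVneq (A `&` C i) set0.
  by rewrite !bochner_null// ?integral_set0 ?ltry.
have CiA := g_sigma_partition_atom tC cC GA Ciw Aw.
by rewrite (setIidr CiA) bochner_Z0_cell.
Qed.

(** [cond_exp] is an arbitrary choice of a version, which is only meaningful once
    some version is known to exist. *)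
Lemma is_cond_exp_cond_exp : is_cond_exp P G X (cond_exp P G X).
Proof. by rewrite /cond_exp; apply: xgetPex; exists Z0. Qed.

Let Z := cond_exp P G X.

Lemma measurable_cond_exp_partition :
  measurable_fun setT (Z : Omega -> borel B).
Proof.
have [ZG _ _] := is_cond_exp_cond_exp.
by move=> _ A mA; rewrite setTI; apply: G_measurable; exact: ZG.
Qed.

(** On a cell, any version is constant since its level sets belong to the
    sigma-algebra; equating the two integrals over the cell gives the constant.
    The value is thus forced pointwise, and not only almost surely, on cells of
    positive mass. *)
Lemma cond_exp_cell i w : (0 < P (C i))%E -> C i w -> Z w = x_ i.
Proof.
move=> Ci0 Ciw; have [ZG _ ZX] := is_cond_exp_cond_exp.
have ZC v : C i v -> Z v = Z w.
  have := g_sigma_partition_atom tC cC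
    (ZG _ (measurable_singleton_borel (Z w))) Ciw erefl.
  exact.
have /ZX : G (C i) by apply: sub_sigma_algebra; exists i.
rewrite (bochner_const sepB P (mC i) measurable_cond_exp_partition ZC).
rewrite /x_ /cell_mean => <-; rewrite scalerA mulVf ?scale1r// gt_eqF//.
by apply: fine_gt0; rewrite Ci0 -ge0_fin_numE//; exact: fin_num_measure.
Qed.

Lemma cond_exp_partition_ae :
  \forall w \ae P,
    Z w = \sum_(i | (0 < P (C i))%E) (\1_(C i) w : R) *: x_ i.
Proof.
(* The exceptional set is the union of the null cells. *)
exists (\bigcup_(i in [set i | P (C i) = 0%E]) C i); split.
- by apply: fin_bigcup_measurable => //; exact: finite_finset.
- rewrite measure_fin_bigcup//; last exact: sub_trivIset tC.
    by rewrite fsbig1.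
  exact: finite_finset.
move=> w /=; apply: contra_notP => nCw.
have [i Ciw] := partition_cell cC w.
rewrite (sum_indic_partition tC _ _ Ciw).
have := measure_ge0 P (C i); rewrite le_eqVlt => /predU1P[Ci0|Ci0].
  by exfalso; apply: nCw; exists i.
by rewrite Ci0; exact: cond_exp_cell.
Qed.

Lemma cond_exp_partition_law (A : set (borel B)) : measurable A ->
  pushforward P (Z : Omega -> borel B) A =
  (\sum_(i | 0 < P (C i)) P (C i) * \d_(x_ i : borel B) A)%E.
Proof.
move=> mA; rewrite /pushforward.
have mZA : measurable (Z @^-1` A).
  by rewrite -[X in measurable X]setTI; exact: measurable_cond_exp_partition.
rewrite (measure_partition P mC tC cC mZA) [RHS]big_mkcond/=.
apply: eq_bigr => i _.
have := measure_ge0 P (C i); rewrite le_eqVlt => /predU1P[Ci0|Ci0].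
  rewrite -Ci0 ltxx; apply: (subset_measure0 _ (mC i) (@subIsetr _ _ _)) => //.
  exact: measurableI.
rewrite Ci0 diracE; have [xA|xA] := boolP (x_ i \in A).
  rewrite mule1; congr (P _); apply/setIidr => w Ciw /=.
  by rewrite (cond_exp_cell Ci0 Ciw); exact: set_mem.
rewrite mule0 (_ : _ `&` _ = set0) ?measure0//.
apply/seteqP; split=> // w [/= ZwA Ciw]; move/negP : xA; apply.
by rewrite -(cond_exp_cell Ci0 Ciw) inE.
Qed.

End cond_exp_partition.

(** * Partitions pulled back by random variables *)

(** A cell of one partition is the finite union of its intersections with the cells
    of the other, and these intersections belong to the join. *)
Lemma g_sigma_join {T : pointedType} {I1 I2 : finType}
    (C1 : I1 -> set T) (C2 : I2 -> set T) :
  cover setT C1 = setT -> cover setT C2 = setT ->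
  <<s <<s range C1 >> `|` <<s range C2 >> >> =
  <<s range (fun ij : I1 * I2 => C1 ij.1 `&` C2 ij.2) >>.
Proof.
move=> cC1 cC2; set C := fun ij : I1 * I2 => _.
have mC i j : <<s range C >> (C1 i `&` C2 j).
  by apply: sub_sigma_algebra; exists (i, j).
have fin_union (J : finType) (F : J -> set T) :
    (forall j, <<s range C >> (F j)) -> <<s range C >> (\bigcup_j F j).
  move=> mF; apply: (@fin_bigcup_measurable _ (g_sigma_algebraType (range C))).
    exact: finite_finset.
  by move=> j _; exact: mF.
apply/seteqP; split; apply: smallest_sub; try exact: smallest_sigma_algebra.
- rewrite subUset; split; (apply: smallest_sub; first exact: smallest_sigma_algebra).
  + move=> _ [i _ <-]; rewrite (_ : C1 i = \bigcup_j (C1 i `&` C2 j)).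
      by apply: fin_union => j; exact: mC.
    by rewrite -setI_bigcupr -/(cover setT C2) cC2 setIT.
  + move=> _ [j _ <-]; rewrite (_ : C2 j = \bigcup_i (C1 i `&` C2 j)).
      by apply: fin_union => i; exact: mC.
    by rewrite -setI_bigcupl -/(cover setT C1) cC1 setTI.
- move=> _ [[i j] _ <-]; set U := _ `|` _.
  apply: (@measurableI _ (g_sigma_algebraType U)); apply: sub_sigma_algebra.
  + by left; apply: sub_sigma_algebra; exists i.
  + by right; apply: sub_sigma_algebra; exists j.
Qed.

Lemma sigma_preimagesE {d} {Omega : measurableType d} {R : realType}
    {B : completeNormedModType R} n (X : Omega -> B) (Pi : 'I_n -> set B) :
  sigma_preimages X Pi = <<s range (fun i => X @^-1` Pi i) >>.
Proof. by rewrite /sigma_preimages image_comp. Qed.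

Section preimage_partition.
Context {T T' : Type} {I : Type} (C : I -> set T') (W : T -> T').

Lemma trivIset_preimage : trivIset setT C -> trivIset setT (fun i => W @^-1` C i).
Proof. by move=> tC i j _ _ [w [Ci Cj]]; apply: tC => //; exists (W w). Qed.

Lemma cover_preimage : cover setT C = setT ->
  cover setT (fun i => W @^-1` C i) = setT.
Proof. by move=> cC; rewrite /cover -preimage_bigcup -/(cover _ _) cC. Qed.

End preimage_partition.

Section partition_setX.
Context {T1 T2 : Type} {I1 I2 : Type} (C1 : I1 -> set T1) (C2 : I2 -> set T2).

Lemma trivIset_setX : trivIset setT C1 -> trivIset setT C2 ->
  trivIset setT (fun ij => C1 ij.1 `*` C2 ij.2).
Proof.
move=> t1 t2 [i j] [i' j'] _ _ [[x y] [[/= xi yj] [xi' yj']]].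
by congr pair; [apply: t1 => //; exists x|apply: t2 => //; exists y].
Qed.

Lemma cover_setX : cover setT C1 = setT -> cover setT C2 = setT ->
  cover setT (fun ij => C1 ij.1 `*` C2 ij.2) = setT.
Proof.
move=> c1 c2; apply/seteqP; split=> // -[x y] _.
have [i _ xi] : cover setT C1 x by rewrite c1.
have [j _ yj] : cover setT C2 y by rewrite c2.
by exists (i, j).
Qed.

End partition_setX.

(** For [1 <= p] one has [x <= 1 + x `^ p] when [x] is nonnegative, and the measure
    is finite. *)
Lemma in_Lp_integrable {d} {Omega : measurableType d} {R : realType}
    {B : completeNormedModType R} (P : probability Omega R) (p : R)
    (X : {RV P >-> borel B}) : 1 <= p -> in_Lp p X ->
  (\int[P]_w `|(X w : B)|%:E < +oo)%E.
Proof.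
move=> p1; rewrite /in_Lp unlock => Xp.
have mX : measurable_fun setT (fun w => `|(X w : B)|).
  exact: measurable_norm_comp.
have mXp : measurable_fun setT (fun w => (`|(X w : B)| `^ p)%:E).
  apply/measurable_EFinP.
  exact: (measurableT_comp (measurable_powR p) mX).
apply: (@le_lt_trans _ _ (\int[P]_w (cst 1 w + (`|(X w : B)| `^ p)%:E))%E).
  apply: ge0_le_integral => //.
  - exact/measurable_EFinP.
  - exact: emeasurable_funD.
  - move=> w _; rewrite -EFinD lee_fin.
    have [x1|/ltW x1] := leP 1 `|(X w : B)|.
      rewrite (le_trans (_ : _ <= `|(X w : B)| `^ p))// ?lerDr//.
      by rewrite -[leLHS]powRr1// ler_powR.
    by rewrite (le_trans x1)// lerDl powR_ge0.
rewrite ge0_integralD//.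
apply: lte_add_pinfty => //; rewrite integral_cst// mul1e.
by rewrite -ge0_fin_numE//; exact: fin_num_measure.
Qed.

(** The variable [f \o W] is conditioned on the cell containing [W]. The pairs of
    interest are [W = X] with [f] the identity, and [W = (X, Y)] with [f] the
    second projection. *)
Section cond_exp_cells.
Context {d} {Omega : measurableType d} {R : realType}
  {B : completeNormedModType R} {d'} {T' : measurableType d'} {I : finType}.
Hypothesis sepB : separable B.
Variables (P : probability Omega R) (W : {mfun Omega >-> T'})
  (f : {mfun T' >-> borel B}) (C : I -> set T').
Hypotheses (mC : forall i, measurable (C i)) (tC : trivIset setT C)
  (cC : cover setT C = setT)
  (foo : (\int[P]_w `|(f (W w) : B)|%:E < +oo)%E).

Let mu := distribution P W.
Let Z := cond_exp P <<s range (fun i => W @^-1` C i) >> (f \o W : Omega -> B).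

Let mfW : measurable_fun setT (f \o W : Omega -> borel B).
Proof. exact: measurableT_comp. Qed.

Let mWC i : measurable (W @^-1` C i).
Proof. exact: measurable_funPTI. Qed.

Lemma cell_mean_distribution (D : set T') : measurable D ->
  cell_mean mu D (f : T' -> B) = cell_mean P (W @^-1` D) (f \o W : Omega -> B).
Proof.
move=> mD; rewrite /cell_mean; congr (_ *: _).
have mWD : measurable (W @^-1` D) by exact: measurable_funPTI.
have mf : measurable_fun setT (f : T' -> borel B) by [].
have fDoo := integral_norm_subset mWD measurableT (@subsetT _ _) mfW foo.
by have [] := bochner_distribution sepB mD mf fDoo.
Qed.

Lemma cond_exp_cells_ae :
  \forall w \ae P, Z w = \sum_(i | (0 < mu (C i))%E)
    (\1_(C i) (W w) : R) *: cell_mean mu (C i) (f : T' -> B).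
Proof.
have := cond_exp_partition_ae sepB mWC (trivIset_preimage tC)
  (cover_preimage _ cC) mfW foo.
apply: filterS => w Zw; apply: (etrans Zw); apply: eq_bigr => i _.
by rewrite cell_mean_distribution.
Qed.

Lemma cond_exp_cells_law (A : set (borel B)) : measurable A ->
  pushforward P (Z : Omega -> borel B) A =
  (\sum_(i | 0 < mu (C i))
    mu (C i) * \d_(cell_mean mu (C i) (f : T' -> B) : borel B) A)%E.
Proof.
move=> mA; under eq_bigr do rewrite cell_mean_distribution//.
exact: (cond_exp_partition_law sepB mWC (trivIset_preimage tC)
  (cover_preimage _ cC) mfW foo).
Qed.

Lemma cell_mean_distribution_barycentre i : (0 < mu (C i))%E ->
  let gamma := pushforward (density mu (cell_density mu (C i))) f in
  is_probability_with_first_moment gamma /\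
  cell_mean mu (C i) (f : T' -> B) = barycentre gamma.
Proof.
move=> Ci0; apply: cell_mean_barycentre => //.
have mf : measurable_fun setT (f : T' -> borel B) by [].
by have [] := bochner_distribution sepB measurableT mf foo.
Qed.

End cond_exp_cells.

Theorem proposition13 (R : realType) (B : completeNormedModType R)
  (sepB : separable B) (d : measure_display) (Omega : measurableType d)
  (P : probability Omega R) (p : R) (p1 : 1 <= p)
  (X : {RV P >-> borel B}) (XLp : in_Lp p X) :
  let mu : set (borel B) -> \bar R := distribution P X in
  let x_ (D : set B) : B := cell_mean mu D (fun x : borel B => x : B) in
  (forall (n1 : nat) (P1 : 'I_n1 -> set B), finite_borel_partition P1 ->
     let Xhat : Omega -> B := cond_exp P (sigma_preimages X P1) X in
     [/\ \forall w \ae P,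
           Xhat w = \sum_(i < n1 | (0 < mu (P1 i))%E)
                      \1_(P1 i) (X w) *: x_ (P1 i),
         forall A : set (borel B), measurable A ->
           pushforward P (Xhat : Omega -> borel B) A =
           (\sum_(i < n1 | 0 < mu (P1 i))
              mu (P1 i) * \d_(x_ (P1 i) : borel B) A)%E &
         forall i, (0 < mu (P1 i))%E ->
           let mu_i := density mu (cell_density mu (P1 i)) in
           is_probability_with_first_moment mu_i /\
           x_ (P1 i) = barycentre mu_i])
  /\
  (forall Y : {RV P >-> borel B}, in_Lp p Y ->
     (\forall w \ae P,
        cond_exp P (g_sigma_algebra_preimage X) (Y : Omega -> B) w = X w) ->
     let pi : set (borel B * borel B) -> \bar R :=
       pushforward P ((fun w => (X w, Y w)) : Omega -> borel B * borel B) in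
     let y_ (D : set (B * B)) : B :=
       cell_mean pi D (fun z : borel B * borel B => z.2 : B) in
     (forall (n1 n2 : nat) (P1 : 'I_n1 -> set B) (P2 : 'I_n2 -> set B),
        finite_borel_partition P1 -> finite_borel_partition P2 ->
        let Yhat : Omega -> B :=
          cond_exp P (<<s sigma_preimages X P1 `|` sigma_preimages Y P2 >>) Y in
        [/\ forall i, (0 < mu (P1 i))%E ->
              x_ (P1 i) = cell_mean pi (P1 i `*` setT)
                            (fun z : borel B * borel B => z.1 : B),
            \forall w \ae P,
              Yhat w =
              \sum_(i < n1) \sum_(j < n2 | (0 < pi (P1 i `*` P2 j))%E)
                 \1_(P1 i `*` P2 j) (X w, Y w) *: y_ (P1 i `*` P2 j),
            forall A : set (borel B), measurable A ->
              pushforward P (Yhat : Omega -> borel B) A =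
              (\sum_(i < n1) \sum_(j < n2 | 0 < pi (P1 i `*` P2 j))
                 pi (P1 i `*` P2 j) *
                 \d_(y_ (P1 i `*` P2 j) : borel B) A)%E &
            forall i j, (0 < pi (P1 i `*` P2 j))%E ->
              let pi_ij := density pi (cell_density pi (P1 i `*` P2 j)) in
              let nu_ij : set (borel B) -> \bar R := pushforward pi_ij snd in
              is_probability_with_first_moment nu_ij /\
              y_ (P1 i `*` P2 j) = barycentre nu_ij])
     /\
     (forall (m1 m2 : nat -> nat) (P1 : forall n, 'I_(m1 n) -> set B)
         (P2 : forall n, 'I_(m2 n) -> set B),
        (forall n, finite_borel_partition (P1 n)) ->
        (forall n, finite_borel_partition (P2 n)) ->
        (forall n, <<s range (P1 n) >> `<=` <<s range (P1 n.+1) >>) ->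
        (forall n, <<s range (P2 n) >> `<=` <<s range (P2 n.+1) >>) ->
        <<s \bigcup_n range (P1 n) >> = @measurable _ (borel B) ->
        <<s \bigcup_n range (P2 n) >> = @measurable _ (borel B) ->
        forall n,
          let X_n : Omega -> B := cond_exp P (sigma_preimages X (P1 n)) X in
          let Y_n : Omega -> B :=
            cond_exp P
              (<<s sigma_preimages X (P1 n) `|` sigma_preimages Y (P2 n) >>) Y in
          (\forall w \ae P,
             X_n w = \sum_(i < m1 n | (0 < mu (P1 n i))%E)
                       \1_(P1 n i) (X w) *: x_ (P1 n i)) /\
          (\forall w \ae P,
             Y_n w =
             \sum_(i < m1 n) \sum_(j < m2 n | (0 < pi (P1 n i `*` P2 n j))%E)
                \1_(P1 n i `*` P2 n j) (X w, Y w) *: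
                y_ (P1 n i `*` P2 n j)))).

Proof.
move=> mu x_.
have Xoo : (\int[P]_w `|(X w : B)|%:E < +oo)%E := in_Lp_integrable p1 XLp.
pose idB : {mfun borel B >-> borel B} :=
  mfun_Sub (mem_set (@measurable_id _ (borel B) setT)).
have partX n1 (P1 : 'I_n1 -> set B) : finite_borel_partition P1 ->
    [/\ \forall w \ae P, cond_exp P (sigma_preimages X P1) X w =
          \sum_(i < n1 | (0 < mu (P1 i))%E) \1_(P1 i) (X w) *: x_ (P1 i),
        forall A : set (borel B), measurable A ->
          pushforward P
            (cond_exp P (sigma_preimages X P1) X : Omega -> borel B) A =
          (\sum_(i < n1 | 0 < mu (P1 i))
              mu (P1 i) * \d_(x_ (P1 i) : borel B) A)%E &
        forall i, (0 < mu (P1 i))%E ->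
          let mu_i := density mu (cell_density mu (P1 i)) in
          is_probability_with_first_moment mu_i /\
          x_ (P1 i) = barycentre mu_i].
  move=> [mP1 tP1 cP1]; rewrite sigma_preimagesE; split.
  - exact: (cond_exp_cells_ae sepB (f := idB) mP1 tP1 cP1 Xoo).
  - exact: (cond_exp_cells_law sepB (f := idB) mP1 tP1 cP1 Xoo).
  - move=> i.
    exact: (@cell_mean_distribution_barycentre _ _ _ _ _ _ _ sepB P X idB).
split=> [//|Y YLp _ pi y_].
have Yoo : (\int[P]_w `|(Y w : B)|%:E < +oo)%E := in_Lp_integrable p1 YLp.
have mXY : measurable_fun setT
    ((fun w => (X w, Y w)) : Omega -> borel B * borel B).
  exact: measurable_fun_pair.
pose XY : {mfun Omega >-> (borel B * borel B)%type} := mfun_Sub (mem_set mXY).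
pose fstB : {mfun (borel B * borel B)%type >-> borel B} :=
  mfun_Sub (mem_set (@measurable_fst _ _ (borel B) (borel B))).
pose sndB : {mfun (borel B * borel B)%type >-> borel B} :=
  mfun_Sub (mem_set (@measurable_snd _ _ (borel B) (borel B))).
have partY n1 n2 (P1 : 'I_n1 -> set B) (P2 : 'I_n2 -> set B) :
    finite_borel_partition P1 -> finite_borel_partition P2 ->
    let Yhat : Omega -> B :=
      cond_exp P (<<s sigma_preimages X P1 `|` sigma_preimages Y P2 >>) Y in
    [/\ \forall w \ae P, Yhat w =
          \sum_(i < n1) \sum_(j < n2 | (0 < pi (P1 i `*` P2 j))%E)
            \1_(P1 i `*` P2 j) (X w, Y w) *: y_ (P1 i `*` P2 j),
        forall A : set (borel B), measurable A ->
          pushforward P (Yhat : Omega -> borel B) A =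
          (\sum_(i < n1) \sum_(j < n2 | 0 < pi (P1 i `*` P2 j))
             pi (P1 i `*` P2 j) * \d_(y_ (P1 i `*` P2 j) : borel B) A)%E &
        forall i j, (0 < pi (P1 i `*` P2 j))%E ->
          let pi_ij := density pi (cell_density pi (P1 i `*` P2 j)) in
          let nu_ij : set (borel B) -> \bar R := pushforward pi_ij snd in
          is_probability_with_first_moment nu_ij /\
          y_ (P1 i `*` P2 j) = barycentre nu_ij].
  move=> [mP1 tP1 cP1] [mP2 tP2 cP2]; rewrite !sigma_preimagesE.
  (* The join is generated by the preimages of rectangles under [(X, Y)], which
     partition the sample space. *)
  rewrite g_sigma_join; [|exact: cover_preimage..].
  pose C (ij : 'I_n1 * 'I_n2) : set (borel B * borel B) :=
    P1 ij.1 `*` P2 ij.2.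
  have mC ij : measurable (C ij) by exact: measurableX.
  have tC : trivIset setT C by exact: trivIset_setX.
  have cC : cover setT C = setT by exact: cover_setX.
  split.
  - have := cond_exp_cells_ae sepB (W := XY) (f := sndB) mC tC cC Yoo.
    apply: filterS => w Zw; rewrite pair_big_dep /=; exact: Zw.
  - move=> A mA; rewrite pair_big_dep /=.
    exact: (cond_exp_cells_law sepB (W := XY) (f := sndB) mC tC cC Yoo).
  - move=> i j.
    exact: (@cell_mean_distribution_barycentre _ _ _ _ _ _ _ sepB P XY sndB
      C mC Yoo (i, j)).
split=> [n1 n2 P1 P2 fP1 fP2 Yhat|m1 m2 P1 P2 fP1 fP2 _ _ _ _ n X_n Y_n].
  have [Yae Ylaw Ybar] := partY _ _ _ _ fP1 fP2; split=> //.
  have [mP1 _ _] := fP1 => i _.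
  (* Both sides are the mean of [X] over the event [X] in [P1 i]. *)
  rewrite /x_ (@cell_mean_distribution _ _ _ _ _ _ sepB P X idB Xoo)//.
  rewrite (@cell_mean_distribution _ _ _ _ _ _ sepB P XY fstB Xoo)//.
    congr (cell_mean P _ _).
    by apply/seteqP; split=> [w Pw|w []//]; split.
  exact: measurableX.
split; first by have [] := partX _ _ (fP1 n).
by have [] := partY _ _ _ _ (fP1 n) (fP2 n).
Qed.
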